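(* Let $p \ge 2$ and $n$ be integers with $2 \leq n \leq p$. Let $X_1,\dots,X_n$ be independent and identically distributed random vectors with distribution $N_p(\mu,\Sigma)$, where $\mu \in \mathbb{R}^p$ and $\Sigma$ is a positive definite $p\times p$ matrix. Let $X = (X_1,\dots,X_n)$ be the $p\times n$ data matrix, let $\bar{X}$ be the $p\times n$ matrix each of whose columns equals $\frac{1}{n}(X_1+\dots+X_n)$, and let $S = \frac{1}{n}(X-\bar{X})(X-\bar{X})^{\top}$ be the sample covariance matrix. Set $k = p-(n-1)$. Then, with probability $1$, for every $\rho \geq 0$ and every $c>0$ with $c < 1 - \frac{k}{p}$, the PCGLASSO optimisation problem $$\min_{\xi_1,\dots,\xi_p > 0,\ \Delta \in \mathcal{S}_1} \; -\log\det(\Delta) - 2c\sum_{i=1}^p \log(\xi_i) + \mathrm{tr}\left(S\,\xi\,\Delta\,\xi\right) + \rho\sum_{i\neq j}|\Delta_{ij}|$$ has a solution, i.e. the infimum of the objective over the feasible set is attained at some feasible point $(\xi,\Delta)$.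
   Context: Here $\xi = \mathrm{diag}(\xi_1,\dots,\xi_p)$ denotes the $p\times p$ diagonal matrix with positive diagonal entries $\xi_i$, and $\mathcal{S}_1$ denotes the set of $p\times p$ symmetric positive definite matrices with all diagonal entries equal to $1$. The parameter $\rho \ge 0$ weights the $\ell_1$ penalty on the off-diagonal entries of $\Delta$ (the sum is over ordered pairs $i \neq j$ in $\{1,\dots,p\}$), and $c>0$ weights the logarithmic term in the $\xi_i$. The precision-matrix estimate corresponding to a solution is $\Theta = \xi\Delta\xi$. *)

(* Defs.v *)
From HB Require Import structures.
From mathcomp Require Import all_boot all_order all_algebra.
From mathcomp Require Import all_classical all_reals all_analysis.
Set Implicit Arguments. Unset Strict Implicit. Unset Printing Implicit Defensive.
Import Order.TTheory GRing.Theory Num.Theory.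
Local Open Scope classical_set_scope.
Local Open Scope ring_scope.

Section PCGlasso.
Context {R : realType}.

Definition posdef (p : nat) (A : 'M[R]_p) : Prop :=
  A^T = A /\ forall v : 'cV[R]_p, v != 0 -> 0 < (v^T *m A *m v) 0 0.

Definition in_S1 (p : nat) (D : 'M[R]_p) : Prop :=
  posdef D /\ forall i, D i i = 1.

Definition pcg_feasible (p : nat) (xi : 'rV[R]_p) (D : 'M[R]_p) : Prop :=
  (forall i, 0 < xi 0 i) /\ in_S1 D.

Definition pcg_obj (p : nat) (S : 'M[R]_p) (c rho : R)
    (xi : 'rV[R]_p) (D : 'M[R]_p) : R :=
  - ln (\det D) - 2 * c * (\sum_(i < p) ln (xi 0 i))
  + \tr (S *m diag_mx xi *m D *m diag_mx xi)
  + rho * (\sum_(i < p) \sum_(j < p | j != i) `|D i j|).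

Definition pcg_has_solution (p : nat) (S : 'M[R]_p) (c rho : R) : Prop :=
  exists xi0 D0, pcg_feasible xi0 D0 /\
    forall xi D, pcg_feasible xi D -> pcg_obj S c rho xi0 D0 <= pcg_obj S c rho xi D.

Definition data_mx (p n : nat) (Xs : 'I_n -> 'cV[R]_p) : 'M[R]_(p, n) :=
  \matrix_(j < p, i < n) Xs i j 0.

Definition mean_mx (p n : nat) (Xs : 'I_n -> 'cV[R]_p) : 'M[R]_(p, n) :=
  \matrix_(j < p, i < n) (n%:R^-1 * \sum_(l < n) Xs l j 0).

Definition sample_cov (p n : nat) (Xs : 'I_n -> 'cV[R]_p) : 'M[R]_p :=
  n%:R^-1 *: ((data_mx Xs - mean_mx Xs) *m (data_mx Xs - mean_mx Xs)^T).

(* X ~ N_p(mu, Sigma) (Cramer-Wold definition): each coordinate is measurable and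
   every nontrivial linear combination a^T X is N(a^T mu, a^T Sigma a)
   (normal_prob takes the standard deviation). *)
Definition gaussian_vector d (Omega : measurableType d) (P : probability Omega R)
    (p : nat) (X : Omega -> 'cV[R]_p) (mu : 'cV[R]_p) (Sigma : 'M[R]_p) : Prop :=
  (forall j, measurable_fun setT (fun w => X w j 0)) /\
  forall a : 'cV[R]_p, a != 0 -> forall B : set R, measurable B ->
    P ((fun w => (a^T *m X w) 0 0) @^-1` B) =
    normal_prob ((a^T *m mu) 0 0) (Num.sqrt ((a^T *m Sigma *m a) 0 0)) B.

(* mutual independence of the random vectors X_1..X_n, tested on measurable
   rectangles (a pi-system containing the whole space generating the Borel
   sigma-algebra of R^p) *)
Definition independent_vectors d (Omega : measurableType d) (P : probability Omega R)
    (p n : nat) (X : 'I_n -> Omega -> 'cV[R]_p) : Prop :=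
  forall B : 'I_n -> 'I_p -> set R, (forall i j, measurable (B i j)) ->
    P [set w | forall i j, B i j (X i w j 0)] =
    \big[*%E/1%E]_(i < n) P [set w | forall j, B i j (X i w j 0)].

End PCGlasso.

(* Main.v *)
Require Import Defs.
From HB Require Import structures.
From mathcomp Require Import all_boot all_order all_algebra all_fingroup.
From mathcomp Require Import all_classical all_reals all_analysis.
From mathcomp Require Import measurable_realfun ring lra.
Import Order.TTheory GRing.Theory Num.Theory.
Import numFieldNormedType.Exports.
Local Open Scope classical_set_scope.
Local Open Scope ring_scope.
Set Implicit Arguments.
Unset Strict Implicit.
Unset Printing Implicit Defensive.

(* Write L = - log det D >= 0 and T = tr (S xi D xi).  For a set I of n - 1
   coordinates, complete n - 1 centered observations, scaled by xi, by the basis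
   vectors outside I.  Hadamard's inequality for the Gram matrix of this family
   with respect to D gives 2 * sum_(i in I) log xi_i <= L + T + C_I, where C_I is
   finite as soon as the I-rows of the centered observations are independent.
   Averaging over the cyclic shifts of I yields
   (n - 1) / p * 2 * sum_i log xi_i <= L + T + C, so when c * p < n - 1 both L
   and T are bounded on sublevel sets.  Hence det D stays away from 0, Hadamard's
   inequality for a single vector bounds xi from above, the logarithmic term
   bounds it from below, and the sublevel sets lie in a compact feasible set.
   The required minors are almost surely nonzero by induction on the number of
   observations: such a minor is affine in the last observation, with a previous
   minor as one of its coefficients, and a nondegenerate Gaussian vector does not
   charge hyperplanes. *)

(** * Hadamard's inequality *)

Section LinearAlgebra.
Context {R : realType}.

Lemma posdef_congr (p : nat) (A V : 'M[R]_p) :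
  posdef A -> V \in unitmx -> posdef (V^T *m A *m V).
Proof.
move=> [As Ap] Vu; split; first by rewrite !trmx_mul trmxK As mulmxA.
move=> v v0; have := Ap (V *m v); rewrite trmx_mul !mulmxA; apply.
by apply: contra v0 => /eqP Vv0; rewrite -[v](mulKmx Vu) Vv0 mulmx0.
Qed.

Lemma posdef_ge0 (p : nat) (A : 'M[R]_p) (v : 'cV[R]_p) :
  posdef A -> 0 <= (v^T *m A *m v) 0 0.
Proof.
move=> [_ Ap]; have [->|v0] := eqVneq v 0; first by rewrite mulmx0 mxE.
exact/ltW/Ap.
Qed.

Lemma mulmx_quad (p m : nat) (A : 'M[R]_p) (Z : 'M[R]_(p, m)) (j : 'I_m) :
  (Z^T *m A *m Z) j j = ((col j Z)^T *m A *m col j Z) 0 0.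
Proof. by rewrite tr_col -!row_mul [in RHS]colE mulmxA -colE !mxE. Qed.

Lemma posdef_diag_gt0 (p : nat) (A : 'M[R]_p) i : posdef A -> 0 < A i i.
Proof.
move=> [_ Ap]; have := Ap (delta_mx i 0).
have -> : ((delta_mx i 0)^T *m A *m (delta_mx i 0) : 'M[R]_1) 0 0 = A i i.
  by rewrite trmx_delta -rowE -colE !mxE.
apply; apply/eqP => /matrixP/(_ i 0); rewrite !mxE !eqxx /=.
by move/eqP; rewrite oner_eq0.
Qed.

(* Elimination of the first row and column: the Schur complement of [A 0 0] is
   positive definite with a smaller diagonal. *)
Lemma posdef_det_bounds (p : nat) (A : 'M[R]_p) :
  posdef A -> 0 < \det A <= \prod_i A i i.
Proof.
elim: p A => [|p IHp] A Apd; first by rewrite det_mx00 big_ord0 ltr01 lexx.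
have a_gt0 := posdef_diag_gt0 ord0 Apd; have [As Ap] := Apd.
pose a := A ord0 ord0; pose A1 : 'M[R]_(1 + p) := A.
have A1s : A1^T = A1 by [].
pose b := dlsubmx A1; pose C := drsubmx A1.
have A1E : A1 = block_mx a%:M b^T b C.
  rewrite -[LHS]submxK; congr block_mx.
    by apply/matrixP=> i j; rewrite !ord1 !mxE eqxx mulr1n !lshift0.
  by rewrite /b trmx_dlsub A1s.
pose C1 := C - a^-1 *: (b *m b^T).
(* The first coordinate is chosen to cancel the first row, so the form of [A1] at this vector equals
   the form of [C1] at [v]. *)
have C1E v : A1 *m col_mx (- (a^-1 *: (b^T *m v))) v = col_mx 0 (C1 *m v).
  rewrite A1E mul_block_col; congr col_mx.
    by rewrite mul_scalar_mx scalerN scalerA divff ?gt_eqF// scale1r addNr.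
  by rewrite mulmxN -scalemxAr mulmxBl -scalemxAl mulmxA addrC.
have C1pd : posdef C1.
  split.
    have Cs : C^T = C by rewrite /C trmx_drsub A1s.
    by rewrite /C1 linearB /= linearZ /= trmx_mul trmxK Cs.
  move=> v v0; pose u : 'cV[R]_(1 + p) := col_mx (- (a^-1 *: (b^T *m v))) v.
  have u0 : u != 0 by rewrite /u col_mx_eq0 negb_and v0 orbT.
  have uE : u^T *m (A1 *m u) = v^T *m (C1 *m v).
    by rewrite /u C1E tr_col_mx mul_row_col mulmx0 add0r.
  by have := Ap u u0; rewrite -mulmxA [_ *m (A *m u)]uE mulmxA.
have detA : \det A = a * \det C1.
  (* Multiplying by the unipotent [E] clears the column below the pivot and leaves [C1] in the lower
     corner. *)
  pose E : 'M[R]_(1 + p) := block_mx 1%:M 0 (- (a^-1 *: b)) 1%:M.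
  have detE : \det E = 1 by rewrite det_lblock !det1 mulr1.
  rewrite -[LHS]mul1r -detE -[\det A]/(\det A1) -det_mulmx A1E mulmx_block.
  rewrite !mul1mx !mul0mx !addr0 mul_mx_scalar scalerN scalerA divff ?gt_eqF//.
  rewrite scale1r addNr mulNmx -scalemxAl [- _ + _]addrC det_ublock.
  by rewrite det_scalar1.
have /andP[C1_gt0 C1_le] := IHp _ C1pd.
rewrite detA mulr_gt0//= big_ord_recl ler_pM2l//.
apply: le_trans C1_le _; apply: ler_prod => i _.
rewrite ltW ?posdef_diag_gt0//= !mxE.
have -> : A (lift ord0 i) (lift ord0 i) = A1 (rshift 1 i) (rshift 1 i).
  by congr (A _ _); apply: val_inj.
rewrite gerBl mulr_ge0 ?invr_ge0 ?(ltW a_gt0)//.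
by rewrite big_ord1 !mxE -expr2 sqr_ge0.
Qed.

Lemma posdef_det_gt0 (p : nat) (A : 'M[R]_p) : posdef A -> 0 < \det A.
Proof. by move/posdef_det_bounds/andP => []. Qed.

(** The diagonal bound for the Gram matrix of the columns of [V]; for singular [V] the left side
    vanishes. *)
Lemma hadamard_congr (p : nat) (A V : 'M[R]_p) : posdef A ->
  (\det V) ^+ 2 * \det A <= \prod_j (V^T *m A *m V) j j.
Proof.
move=> Apd; have [V0|V0] := eqVneq (\det V) 0.
  rewrite V0 expr0n mul0r prodr_ge0// => j _.
  by rewrite mulmx_quad posdef_ge0.
have Vu : V \in unitmx by rewrite unitmxE unitfE.
have /andP[_] := posdef_det_bounds (posdef_congr Apd Vu).
by rewrite !det_mulmx det_tr mulrAC -expr2.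
Qed.

(* Complete [Z] to a square matrix by the basis vectors outside the rows
   selected by [s], and apply Hadamard's inequality to the Gram matrix. *)
Lemma hadamard_rows (r q : nat) (Z : 'M[R]_(r + q, r)) (D : 'M[R]_(r + q))
    (s : 'S_(r + q)) : in_S1 D ->
  (\det (\matrix_(i < r, j < r) Z (s (lshift q i)) j)) ^+ 2 * \det D
    <= \prod_(j < r) (Z^T *m D *m Z) j j.
Proof.
move=> [Dpd D1].
pose E : 'M[R]_(r + q, q) := \matrix_(i, j) (i == s (rshift r j))%:R.
have ED i : (E^T *m D *m E) i i = 1.
  rewrite mulmx_quad.
  have -> : col i E = delta_mx (s (rshift r i)) 0.
    by apply/colP => k; rewrite !mxE andbT.
  by rewrite trmx_delta -rowE -colE !mxE D1.
pose V := row_mx Z E.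
have := hadamard_congr V Dpd.
have -> : \prod_j (V^T *m D *m V) j j = \prod_j (Z^T *m D *m Z) j j.
  rewrite big_split_ord /= [X in _ * X]big1 ?mulr1 => [|i _].
    apply: eq_bigr => i _.
    by rewrite tr_row_mx mul_col_mx mul_col_row block_mxEul.
  by rewrite tr_row_mx mul_col_mx mul_col_row block_mxEdr ED.
suff -> : (\det V) ^+ 2 =
    (\det (\matrix_(i < r, j < r) Z (s (lshift q i)) j)) ^+ 2 by [].
(* After permuting by [s] the selected rows come first and meet only zeros of [E], while the
   remaining rows of [E] form the identity: the matrix is block triangular. *)
have : \det (row_perm s V) = \det (\matrix_(i < r, j < r) Z (s (lshift q i)) j).
  rewrite -[row_perm s V]submxK.
  have -> : ursubmx (row_perm s V) = 0.
    apply/matrixP => i j; rewrite !mxE; case: split_ordP => k.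
      by move/eqP; rewrite eq_sym eq_lrshift.
    by move=> _; rewrite !mxE (inj_eq perm_inj) eq_lrshift.
  have -> : drsubmx (row_perm s V) = 1%:M.
    apply/matrixP => i j; rewrite !mxE; case: split_ordP => k.
      by move/eqP; rewrite eq_sym eq_lrshift.
    by move=> /rshift_inj <-; rewrite !mxE (inj_eq perm_inj) eq_rshift.
  rewrite det_lblock det1 mulr1; congr (\det _).
  apply/matrixP => i j; rewrite !mxE; case: split_ordP => k.
    by move=> /lshift_inj <-.
  by move/eqP; rewrite eq_lrshift.
rewrite row_permE det_mulmx det_perm => <-.
by rewrite exprMn sqrr_sign mul1r.
Qed.

End LinearAlgebra.

(** * Coercivity of the objective *)

Section Coercivity.
Context {R : realType}.

(** The one-column case of [hadamard_rows], with coordinate [j] moved to the front. It turns a lower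
    bound on the determinant into uniform positive definiteness. *)
Lemma posdef_ge_coord (p : nat) (D : 'M[R]_p) (v : 'cV[R]_p) j :
  in_S1 D -> \det D * v j 0 ^+ 2 <= (v^T *m D *m v) 0 0.
Proof.
case: p D v j => [|p] D v j D1; first by case: j.
have := @hadamard_rows R 1 p v D (tperm ord0 j) D1.
rewrite big_ord1 mulrC; congr (_ * _ ^+ 2 <= _).
rewrite [X in \det X](_ : _ = (v j 0)%:M) ?det_scalar1//.
apply/matrixP => i k; rewrite !ord1 !mxE eqxx mulr1n.
by rewrite (_ : lshift p 0 = ord0) ?tpermL//; apply: val_inj.
Qed.

Lemma in_S1_det_le1 (p : nat) (D : 'M[R]_p) : in_S1 D -> \det D <= 1.
Proof.
move=> [Dpd D1]; have /andP[_ /le_trans] := posdef_det_bounds Dpd; apply.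
by rewrite big1.
Qed.

Lemma pcg_feasible_posdef (p : nat) (xi : 'rV[R]_p) (D : 'M[R]_p) :
  pcg_feasible xi D -> posdef (diag_mx xi *m D *m diag_mx xi).
Proof.
move=> [xi0 [Dpd _]]; rewrite -{1}tr_diag_mx; apply: posdef_congr => //.
rewrite unitmxE det_diag unitfE; apply/prodf_neq0 => i _.
by rewrite gt_eqF.
Qed.

Lemma ln_prod (I : finType) (F : I -> R) : (forall i, 0 < F i) ->
  ln (\prod_i F i) = \sum_i ln (F i).
Proof.
move=> F0; apply: (@proj1 _ (0 < \prod_i F i)).
elim/big_rec2: _ => [|i y x _ [yE x0]]; first by rewrite ln1.
by rewrite lnM ?posrE// yE mulr_gt0.
Qed.

Section Sublevel.
(** In the application [r.+1] is n - 1, [q] is p - (n - 1), and the columns of [Z] are all centered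
    observations but the last, scaled so that [SZ] amounts to dropping the last one. *)
Variables (r q : nat) (S : 'M[R]_(r.+1 + q)) (Z : 'M[R]_(r.+1 + q, r.+1)).
Hypothesis SZ : forall T, posdef T -> \tr (Z^T *m T *m Z) <= \tr (S *m T).
Let minor (s : 'S_(r.+1 + q)) : 'M[R]_(r.+1) :=
  \matrix_(i < r.+1, j < r.+1) Z (s (lshift q i)) j.
Hypothesis minor_neq0 : forall s, \det (minor s) != 0.

Let trace_ge (xi : 'rV[R]_(r.+1 + q)) (D : 'M[R]_(r.+1 + q)) :
  pcg_feasible xi D ->
  \sum_(j < r.+1) ((diag_mx xi *m Z)^T *m D *m (diag_mx xi *m Z)) j j <=
    \tr (S *m diag_mx xi *m D *m diag_mx xi).
Proof.
move=> /pcg_feasible_posdef /SZ; rewrite !mulmxA; apply: le_trans.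
by rewrite trmx_mul tr_diag_mx.
Qed.

(** Logarithm of [hadamard_rows] for [diag_mx xi *m Z]: the selected entries of [xi] factor out of
    the minor, and [ln x <= x] replaces the product of diagonal entries by their sum. *)
Let ln_minor_le (xi : 'rV[R]_(r.+1 + q)) (D : 'M[R]_(r.+1 + q))
    (s : 'S_(r.+1 + q)) :
  pcg_feasible xi D ->
  2 * \sum_(i < r.+1) ln (xi 0 (s (lshift q i))) + ln (\det (minor s) ^+ 2)
    + ln (\det D) <= \tr (S *m diag_mx xi *m D *m diag_mx xi).
Proof.
move=> xiD; apply: le_trans _ (trace_ge xiD); have [xi0 D1] := xiD.
have D0 := posdef_det_gt0 (proj1 D1).
have := @hadamard_rows R r.+1 q (diag_mx xi *m Z) D s D1.
set M := (X in \det X).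
have -> : M = diag_mx (\row_i xi 0 (s (lshift q i))) *m minor s.
  by apply/matrixP => i j; rewrite mxE !mul_diag_mx !mxE.
rewrite det_mulmx det_diag.
set P := (X in (X * _) ^+ 2).
have P0 : 0 < P by apply: prodr_gt0 => i _; rewrite mxE.
have lnP : ln (P ^+ 2) = 2 * \sum_(i < r.+1) ln (xi 0 (s (lshift q i))).
  rewrite lnXn// ln_prod => [|i]; last by rewrite mxE.
  by rewrite mulr_natl; congr (_ *+ 2); apply: eq_bigr => i _; rewrite mxE.
have m0 : 0 < \det (minor s) ^+ 2 by rewrite exprn_even_gt0//= minor_neq0.
set F := (_^T *m D *m _).
have P2 : 0 < P ^+ 2 by rewrite exprn_gt0.
have Pm0 : 0 < P ^+ 2 * \det (minor s) ^+ 2 by exact: mulr_gt0.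
have PmD0 : 0 < P ^+ 2 * \det (minor s) ^+ 2 * \det D by exact: mulr_gt0.
rewrite -lnP -!lnM ?posrE// exprMn => le1.
have F0 j : 0 <= F j j by rewrite /F mulmx_quad; apply: posdef_ge0 (proj1 D1).
have prodF0 : 0 < \prod_j F j j by exact: lt_le_trans le1.
have {}F0 j : 0 < F j j.
  rewrite lt_neqAle F0 andbT eq_sym.
  by move: (lt0r_neq0 prodF0) => /prodf_neq0; apply.
apply: le_trans (_ : ln (\prod_j F j j) <= _).
  by rewrite ler_ln ?posrE.
rewrite ln_prod// ler_sum// => j _; exact/ltW/ln_sublinear.
Qed.

(* Summing over the cyclic shifts of the first [r.+1] coordinates gives each
   coordinate the same weight. *)
Let sum_ln_le : exists C : R, forall xi D, pcg_feasible xi D ->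
  r.+1%:R * (2 * \sum_i ln (xi 0 i)) <=
    (r.+1 + q)%:R * (\tr (S *m diag_mx xi *m D *m diag_mx xi) - ln (\det D)) + C.
Proof.
(* ['I_(r + q).+1] serves as the cyclic group of order p, and [sh s] is translation by [s]. *)
pose sh (s : 'I_(r + q).+1) : 'S_(r.+1 + q) := perm (@addIr 'I_(r + q).+1 s).
exists (- \sum_s ln (\det (minor (sh s)) ^+ 2)) => xi D xiD.
have := ler_sum (index_enum _) (fun s (_ : true) => ln_minor_le (sh s) xiD).
rewrite sumr_const card_ord -[in leRHS]mulr_natl !big_split/= sumr_const.
rewrite card_ord -[in X in _ + X]mulr_natl -mulr_sumr exchange_big/=.
rewrite (eq_bigr (fun=> \sum_i ln (xi 0 i))) => [|j _].
  rewrite sumr_const card_ord -[_ *+ r.+1]mulr_natl => h.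
  by rewrite mulrCA mulrBr addrAC; lra.
(* For fixed [j] the translates of [lshift q j] run exactly once through all coordinates. *)
rewrite [RHS](reindex_inj (@addrI 'I_(r + q).+1 (lshift q j)))/=.
by apply: eq_bigr => i _; rewrite permE.
Qed.

Lemma sublevel_bounds (c rho K : R) : 0 <= rho -> 0 < c ->
  c * (r.+1 + q)%:R < r.+1%:R ->
  exists m M delta : R, [/\ 0 < m, 0 < delta &
    forall xi D, pcg_feasible xi D -> pcg_obj S c rho xi D <= K ->
      (forall i, m <= xi 0 i <= M) /\
      (forall (v : 'cV[R]_(r.+1 + q)) j,
        delta * v j 0 ^+ 2 <= (v^T *m D *m v) 0 0)].
Proof.
move=> rho0 c0 cp; have [C sumC] := sum_ln_le.
pose p : R := (r.+1 + q)%:R; pose k : R := r.+1%:R.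
have k0 : 0 < k by rewrite ltr0n.
(* With [T] the trace and [L = ln (\det D)], adding [k] times the sublevel inequality to [c] times
   [sum_ln_le] cancels the logarithms of [xi] and leaves
   [(k - c * p) * (T - L) <= k * K + c * C]. *)
pose K1 := (k * K + c * C) / (k - c * p).
have kcp0 : 0 < k - c * p by rewrite subr_gt0.
pose delta := expR (- K1); have delta0 : 0 < delta by exact: expR_gt0.
pose w j := \sum_k Z j k ^+ 2.
have wge0 j k' : true -> 0 <= Z j k' ^+ 2 by move=> _; exact: sqr_ge0.
have w0 j : 0 < w j.
  have wj0 : 0 <= w j by apply: sumr_ge0 => i _; exact: sqr_ge0.
  (* If [w j] were zero, any minor using row [j] would have a zero row. *)
  rewrite lt_neqAle wj0 andbT eq_sym; apply/eqP => wj.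
  have := minor_neq0 (tperm (lshift q ord0) j).
  rewrite (expand_det_row _ ord0) big1 ?eqxx// => i _.
  rewrite mxE tpermL; have /eqP := psumr_eq0P (wge0 j) wj (i := i) isT.
  by rewrite sqrf_eq0 => /eqP ->; rewrite mul0r.
(* Chosen from [delta * w i * xi 0 i ^+ 2 <= T <= K1]. The added 1 yields [xi 0 i <= M] from
   [xi 0 i ^+ 2 <= M1], and also [0 <= ln M]. *)
pose M1 := \sum_j `|K1| / (delta * w j); pose M := 1 + M1.
have M1ge j : `|K1| / (delta * w j) <= M1.
  rewrite /M1 (bigD1 j)//= lerDl sumr_ge0// => i _.
  by rewrite divr_ge0// mulr_ge0// ltW.
have M1_0 : 0 <= M1.
  by apply: le_trans (M1ge (lshift q ord0)); rewrite divr_ge0// mulr_ge0// ltW.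
have M0 : 0 < M by rewrite /M ltr_pwDl.
have lnM0 : 0 <= ln M by rewrite ln_ge0// /M lerDl.
(* The sublevel inequality bounds the sum of the [ln (xi 0 i)] below by the first term; every other
   logarithm is at most [ln M], which bounds each one below. *)
exists (expR (- (`|K| / (2 * c)) - p * ln M)), M, delta.
split=> [||xi D xiD objK]; [exact: expR_gt0 | by [] |].
have [xi0 D1] := xiD; have detD0 := posdef_det_gt0 (proj1 D1).
have := sumC _ _ xiD; have := trace_ge xiD.
move: objK; rewrite /pcg_obj.
set pen := rho * _; set T := \tr _; set L := ln (\det D); set Sg := \sum_i ln _.
set G := (_^T *m D *m _) => objK.
have G0 j : 0 <= G j j by rewrite /G mulmx_quad; apply: posdef_ge0 (proj1 D1).
have pen0 : 0 <= pen.
  by rewrite mulr_ge0// sumr_ge0// => i _; rewrite sumr_ge0.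
have L0 : L <= 0 by rewrite ln_le0// in_S1_det_le1.
rewrite -/p -/k => GT kSg.
have T0 : 0 <= T by apply: le_trans GT; rewrite sumr_ge0.
have TL : T - L <= K1.
  rewrite /K1 ler_pdivlMr//.
  have h1 : k * (- L - 2 * c * Sg + T) <= k * K.
    by rewrite ler_pM2l//; apply: le_trans objK; rewrite lerDl.
  have h2 : c * (k * (2 * Sg)) <= c * (p * (T - L) + C) by rewrite ler_pM2l.
  by lra.
have detD : delta <= \det D.
  rewrite -[leRHS]lnK ?posrE// ler_expR -/L; lra.
have low (v : 'cV[R]_(r.+1 + q)) j : delta * v j 0 ^+ 2 <= (v^T *m D *m v) 0 0.
  by apply: le_trans (posdef_ge_coord v j D1); rewrite ler_wpM2r ?sqr_ge0.
have xiM i : xi 0 i <= M.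
  have : delta * w i * xi 0 i ^+ 2 <= `|K1|.
    apply: (@le_trans _ _ T); last by apply: le_trans (ler_norm _); lra.
    apply: le_trans GT; rewrite -mulrA mulr_suml mulr_sumr ler_sum// => j _.
    rewrite /G mulmx_quad; apply: le_trans (low _ i).
    by rewrite mxE mul_diag_mx mxE exprMn [xi _ _ ^+ 2 * _]mulrC mulrA.
  rewrite mulrC -ler_pdivlMr ?mulr_gt0// => /le_trans /(_ (M1ge i)) h.
  by rewrite /M; have := xi0 i; nra.
split=> // i; rewrite xiM andbT -[leRHS]lnK ?posrE// ler_expR.
have Sg_ge : - (`|K| / (2 * c)) <= Sg.
  rewrite -mulNr ler_pdivrMr ?mulr_gt0//.
  have := ler_norm K; lra.
apply: (@le_trans _ _ (Sg - p * ln M)); first by lra.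
have : Sg - ln (xi 0 i) <= p * ln M.
  rewrite /Sg (bigD1 i)//= addrC addrK.
  apply: (@le_trans _ _ (\sum_(j < r.+1 + q) ln M)).
    rewrite [leRHS](bigD1 i)//=; apply: ler_wpDl => //.
    by apply: ler_sum => j _; rewrite ler_ln ?posrE.
  by rewrite sumr_const card_ord -mulr_natl.
lra.
Qed.

End Sublevel.
End Coercivity.

(** * Compactness of sublevel sets *)

Section Existence.
Context {R : realType}.

Lemma continuous_at_sumr (T : topologicalType) (I : Type) (r : seq I)
    (P : pred I) (F : I -> T -> R) x :
  (forall i, continuous_at x (F i)) ->
  continuous_at x (fun y => \sum_(i <- r | P i) F i y).
Proof.
by move=> cF; apply: (cvg_big add_continuous) => i _; exact: cF.
Qed.

Lemma continuous_sumr (T : topologicalType) (I : Type) (r : seq I) (P : pred I)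
    (F : I -> T -> R) :
  (forall i, continuous (F i)) ->
  continuous (fun x => \sum_(i <- r | P i) F i x).
Proof. by move=> cF x; apply: continuous_at_sumr => i; exact: cF. Qed.

Lemma continuous_prodr (T : topologicalType) (I : Type) (r : seq I) (P : pred I)
    (F : I -> T -> R) :
  (forall i, continuous (F i)) ->
  continuous (fun x => \prod_(i <- r | P i) F i x).
Proof.
by move=> cF; apply: continuous_big => // x; exact: mul_continuous.
Qed.

Lemma continuous_at_addr (T : topologicalType) (f g : T -> R) x :
  continuous_at x f -> continuous_at x g ->
  continuous_at x (fun y => f y + g y).
Proof. exact: continuousD. Qed.

Lemma continuous_at_mulr (T : topologicalType) (f g : T -> R) x :
  continuous_at x f -> continuous_at x g ->
  continuous_at x (fun y => f y * g y).
Proof. exact: continuousM. Qed.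

Lemma continuous_at_oppr (T : topologicalType) (f : T -> R) x :
  continuous_at x f -> continuous_at x (fun y => - f y).
Proof. exact: continuousN. Qed.

Lemma continuous_at_ln (T : topologicalType) (f : T -> R) x :
  0 < f x -> continuous_at x f -> continuous_at x (fun y => ln (f y)).
Proof. by move=> fx0 cf; apply: continuous_comp cf _; exact: continuous_ln. Qed.

Definition mx_continuous (T : topologicalType) (m n : nat)
  (A : T -> 'M[R]_(m, n)) := forall i j, continuous (fun x => A x i j).

Lemma mx_continuous_cst (T : topologicalType) (m n : nat) (A : 'M[R]_(m, n)) :
  mx_continuous (fun _ : T => A).
Proof. by move=> i j x; exact: cst_continuous. Qed.

Lemma mx_continuous_mul (T : topologicalType) (m n p : nat)
    (A : T -> 'M[R]_(m, n)) (B : T -> 'M[R]_(n, p)) :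
  mx_continuous A -> mx_continuous B -> mx_continuous (fun x => A x *m B x).
Proof.
move=> cA cB i j.
under eq_fun do rewrite mxE.
apply: continuous_sumr => k x.
by apply: continuous_at_mulr; [exact: cA | exact: cB].
Qed.

Lemma mx_continuous_mull (T : topologicalType) (m n p : nat) (C : 'M[R]_(m, n))
    (A : T -> 'M[R]_(n, p)) :
  mx_continuous A -> mx_continuous (fun x => C *m A x).
Proof. exact/mx_continuous_mul/mx_continuous_cst. Qed.

Lemma mx_continuous_mulr (T : topologicalType) (m n p : nat)
    (A : T -> 'M[R]_(m, n)) (C : 'M[R]_(n, p)) :
  mx_continuous A -> mx_continuous (fun x => A x *m C).
Proof.
by move=> cA; apply: (mx_continuous_mul (B := fun=> C)) => //;
  exact: mx_continuous_cst.
Qed.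

Lemma mx_continuous_diag (T : topologicalType) (n : nat) (A : T -> 'rV[R]_n) :
  mx_continuous A -> mx_continuous (fun x => diag_mx (A x)).
Proof.
move=> cA i j; under eq_fun do rewrite mxE.
by case: eqP => _; [exact: cA | move=> x; exact: cst_continuous].
Qed.

Lemma mx_continuous_tr (T : topologicalType) (n : nat) (A : T -> 'M[R]_n) :
  mx_continuous A -> continuous (fun x => \tr (A x)).
Proof. by move=> cA; apply: continuous_sumr => i. Qed.

Lemma mx_continuous_det (T : topologicalType) (n : nat) (A : T -> 'M[R]_n) :
  mx_continuous A -> continuous (fun x => \det (A x)).
Proof.
move=> cA; rewrite /determinant; apply: continuous_sumr => s x.
apply: (@continuous_at_mulr _ (fun=> (-1) ^+ s)).
  exact: cst_continuous.
by apply: continuous_prodr => i.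
Qed.

Lemma posdef1 (p : nat) : posdef (1%:M : 'M[R]_p).
Proof.
split=> [|v v0]; first by rewrite trmx1.
have sq0 i : true -> 0 <= v^T 0 i * v i 0 by rewrite mxE -expr2 sqr_ge0.
rewrite mulmx1 mxE lt_neqAle sumr_ge0 // andbT eq_sym.
apply: contra v0 => /eqP h; apply/eqP/colP => i.
have /eqP := psumr_eq0P sq0 h (i := i) isT.
by rewrite !mxE mulf_eq0 orbb => /eqP.
Qed.

Lemma pcg_feasible1 (p : nat) : pcg_feasible (const_mx 1 : 'rV[R]_p) 1%:M.
Proof.
split=> [i|]; first by rewrite mxE ltr01.
by split=> [|i]; [exact: posdef1 | rewrite mxE eqxx].
Qed.

(** The quadratic form at [e_i + e_j] and [e_i - e_j] is [2 + 2 * D i j] and [2 - 2 * D i j]. *)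
Lemma in_S1_offdiag (p : nat) (D : 'M[R]_p) i j : in_S1 D -> `|D i j| <= 1.
Proof.
move=> [[Ds Dp] D1]; have [<-|ij] := eqVneq i j; first by rewrite D1 normr1.
have quad (e : R) : 0 < 1 + e ^+ 2 + 2 * e * D i j.
  have := Dp (delta_mx i 0 + e *: delta_mx j 0).
  set v := (X in X != 0).
  have v0 : v != 0.
    apply/eqP => /colP/(_ i); rewrite !mxE !eqxx (negbTE ij) /= mulr0 addr0.
    by apply/eqP; rewrite oner_eq0.
  move=> /(_ v0); congr (0 < _).
  have -> : v^T = 'e_i + e *: 'e_j.
    by apply/matrixP => k l; rewrite !ord1 !mxE !andbT.
  rewrite /v !mulmxDl !mulmxDr.
  rewrite -!scalemxAl -!scalemxAr -?scalemxAl -!rowE -!colE !mxE.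
  rewrite !D1 (_ : D j i = D i j); last by rewrite -[in LHS]Ds mxE.
  ring.
have := quad 1; have := quad (-1); rewrite ler_norml; lra.
Qed.

Section Compactness.
Import ArrowAsProduct.
Variables (p : nat) (S : 'M[R]_p) (c rho m M delta : R).
Hypotheses (m0 : 0 < m) (delta0 : 0 < delta).

(** A pair [(xi, D)] is encoded as a point of a product of real lines, so that compactness of boxes
    is Tychonoff's theorem. *)
Let Ix : Type := ('I_p + 'I_p * 'I_p)%type.
Let T : topologicalType := prod_topology (fun _ : Ix => R).
Let xi_of (f : T) : 'rV[R]_p := \row_i f (inl i).
Let D_of (f : T) : 'M[R]_p := \matrix_(i, j) f (inr (i, j)).

Let continuous_coord (i : Ix) : continuous (fun f : T => f i).
Proof. exact: (@proj_continuous _ (fun _ : Ix => R) i). Qed.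

Let continuous_xi : mx_continuous xi_of.
Proof.
move=> i j; under eq_fun do rewrite mxE; exact: continuous_coord.
Qed.

Let continuous_D : mx_continuous D_of.
Proof.
move=> i j; under eq_fun do rewrite mxE; exact: continuous_coord.
Qed.

Let box (k : Ix) : set R :=
  match k with
  | inl _ => `[m, M]%classic
  | inr ij => if ij.1 == ij.2 then `[1, 1]%classic else `[-1, 1]%classic
  end.

(** A closed substitute for positive definiteness: at a nonzero vector some coordinate makes the
    lower bound strictly positive. *)
Let quad_bounded : set T := \bigcap_(vj in [set: 'cV[R]_p * 'I_p])
  [set f | 0 <= (vj.1^T *m D_of f *m vj.1) 0 0 - delta * vj.1 vj.2 0 ^+ 2].

Let symmetric : set T := \bigcap_(ij in [set: 'I_p * 'I_p])
  [set f | D_of f ij.1 ij.2 - D_of f ij.2 ij.1 = 0].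

Let K : set T := [set f | forall k, box k (f k)] `&` (quad_bounded `&` symmetric).

Let compact_K : compact K.
Proof.
apply: compact_closedI.
  apply: (@tychonoff _ (fun _ : Ix => R) box) => -[i|[i j]]/=.
    exact: segment_compact.
  by case: ifP => _; exact: segment_compact.
apply: closedI; apply: closed_bigI => -[v j] _ /=.
  apply: (@preimage_closed _ _
    (fun f => (v^T *m D_of f *m v) 0 0 - delta * v j 0 ^+ 2) [set x | 0 <= x]).
    move=> f _; apply: (@continuous_at_addr _ _ (fun=> - (delta * v j 0 ^+ 2)));
      last exact: cst_continuous.
    exact/mx_continuous_mulr/mx_continuous_mull.
  exact: closed_ge.
apply: (@preimage_closed _ _ (fun f => D_of f v j - D_of f j v) [set x | x = 0]).
  move=> f _.
  apply: (@continuous_at_addr _ (fun g => D_of g v j) (fun g => - D_of g j v)).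
    exact: continuous_D.
  exact/continuous_at_oppr/continuous_D.
exact: closed_eq.
Qed.

Let K_feasible f : K f -> pcg_feasible (xi_of f) (D_of f).
Proof.
move=> [boxf [quadf symf]]; split=> [i|].
  rewrite mxE; have := boxf (inl i); rewrite /= in_itv/= => /andP[+ _].
  exact: lt_le_trans.
split; last first.
  move=> i; rewrite mxE; have := boxf (inr (i, i)); rewrite /= eqxx /= in_itv/=.
  by move=> /le_anti.
split.
  apply/matrixP => i j; rewrite mxE.
  by apply/eqP; rewrite -subr_eq0; apply/eqP; exact: (symf (j, i)).
move=> v v0; have [j vj0] : exists j, v j 0 != 0.
  apply/existsP; rewrite -negb_forall; apply: contra v0 => /forallP h.
  by apply/eqP/colP => j; rewrite mxE; apply/eqP.
have := quadf (v, j) I; rewrite /= subr_ge0; apply: lt_le_trans.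
by rewrite mulr_gt0// exprn_even_gt0//= vj0.
Qed.

Lemma minimum_attained :
  (forall xi D, pcg_feasible xi D ->
    pcg_obj S c rho xi D <= pcg_obj S c rho (const_mx 1) 1%:M ->
      (forall i, m <= xi 0 i <= M) /\
      (forall (v : 'cV[R]_p) j, delta * v j 0 ^+ 2 <= (v^T *m D *m v) 0 0)) ->
  pcg_has_solution S c rho.
Proof.
move=> bounds.
pose obj (f : T) := pcg_obj S c rho (xi_of f) (D_of f).
(* At points of [K] the determinant and the entries of [xi] are positive, so the logarithms are
   continuous there. *)
have cobj : {within K, continuous obj}.
  apply: continuous_in_subspaceT => f /set_mem Kf.
  have [xi0 [Dpd _]] := K_feasible Kf.
  rewrite /obj /pcg_obj.
  apply: continuous_at_addr; last first.
    apply: (@continuous_at_mulr _ (fun=> rho)); first exact: cst_continuous.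
    apply: continuous_sumr => i; apply: continuous_sumr => j g.
    apply: continuous_comp; first exact: continuous_D.
    exact: norm_continuous.
  apply: continuous_at_addr; last first.
    have cdiag := mx_continuous_diag continuous_xi.
    apply: mx_continuous_tr; apply: mx_continuous_mul => //.
    by apply: mx_continuous_mul => //; exact: mx_continuous_mull.
  apply: continuous_at_addr; last apply: continuous_at_oppr.
    apply/continuous_at_oppr/continuous_at_ln; first exact: posdef_det_gt0.
    exact: mx_continuous_det.
  apply: (@continuous_at_mulr _ (fun=> 2 * c)); first exact: cst_continuous.
  apply: continuous_at_sumr => i.
  apply: continuous_at_ln; first exact: xi0.
  exact: continuous_xi.
have K_of xi D : pcg_feasible xi D ->
    pcg_obj S c rho xi D <= pcg_obj S c rho (const_mx 1) 1%:M ->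
    exists f, [/\ K f, xi_of f = xi & D_of f = D].
  move=> xiD /(bounds _ _ xiD)[ximM quadD].
  pose f : T := fun k => match k with inl i => xi 0 i | inr ij => D ij.1 ij.2 end.
  have fxi : xi_of f = xi by apply/rowP => i; rewrite mxE.
  have fD : D_of f = D by apply/matrixP => i j; rewrite mxE.
  have [_ D1] := xiD; exists f; split=> //; split.
    move=> [i|[i j]]/=; first by rewrite in_itv/= ximM.
    case: eqP => [->|_]; rewrite /= in_itv/=.
      by rewrite (proj2 D1) lexx.
    by rewrite -ler_norml in_S1_offdiag.
  split=> -[v j] _ /=; rewrite fD; first by rewrite subr_ge0.
  by rewrite -[in X in X - _](proj1 (proj1 D1)) mxE subrr.
have [f1 [Kf1 xi1 D1]] := K_of _ _ (pcg_feasible1 p) (lexx _).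
have [f /set_mem Kf fmin] := compact_EVT_min (ex_intro _ f1 Kf1) compact_K cobj.
exists (xi_of f), (D_of f); split=> [|xi D xiD]; first exact: K_feasible.
(* Below the value at the identity, the point lies in [K]; above it, the minimiser already beats the
   identity, which lies in [K]. *)
have [le1|/ltW le1] :=
  leP (pcg_obj S c rho xi D) (pcg_obj S c rho (const_mx 1) 1%:M).
  by have [g [Kg <- <-]] := K_of _ _ xiD le1; apply/fmin/mem_set.
by apply: le_trans le1; rewrite -xi1 -D1; apply/fmin/mem_set.
Qed.

End Compactness.
End Existence.

(** * General position of independent Gaussian vectors *)

Section AffineMinors.
Context {R : realType} {p : nat}.
Variable f : nat -> 'I_p.

(** Its determinant detects affine dependence of [m] points projected to coordinates
    [f 0, ..., f (m - 2)]. Indexing by [nat] lets [m] vary in inductions. *)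
Definition affine_mx (m : nat) (x : nat -> 'cV[R]_p) : 'M[R]_m :=
  \matrix_(i < m, j < m) if (j : nat) is k.+1 then x i (f k) 0 else 1.

Lemma eq_affine_mx m x y : (forall i, (i < m)%N -> x i = y i) ->
  affine_mx m x = affine_mx m y.
Proof.
by move=> xy; apply/matrixP => i j; rewrite !mxE xy.
Qed.

(** Expansion along the last row: the cofactor of the constant column is [b], the others form [a].
    Since [f m] differs from the earlier [f k], only the last column contributes to [a (f m) 0],
    with cofactor the previous minor. *)
Lemma affine_mx_expand (m : nat) (x : nat -> 'cV[R]_p) :
  (forall k, (k < m)%N -> f k != f m) ->
  exists (a : 'cV[R]_p) (b : R), a (f m) 0 = \det (affine_mx m.+1 x) /\
    forall y, \det (affine_mx m.+2 (fun i => if i == m.+1 then y else x i)) =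
      (a^T *m y) 0 0 + b.
Proof.
move=> finj; pose A := affine_mx m.+2 x.
have cofE y j : cofactor (affine_mx m.+2 (fun i => if i == m.+1 then y else x i))
    ord_max j = cofactor A ord_max j.
  rewrite /cofactor; congr (_ * \det _); apply/matrixP => i k.
  rewrite !mxE lift_max ltn_eqF//; exact: ltn_ord.
pose cof k : R := cofactor A ord_max (lift ord0 k).
exists (\sum_k cof k *: delta_mx (f k) 0), (cofactor A ord_max ord0).
split=> [|y].
  rewrite summxE (bigD1 ord_max)//= big1 => [|k kmax]; last first.
    rewrite !mxE eq_sym (negbTE (finj _ _)) ?mulr0//.
    by rewrite ltn_neqAle -(inj_eq val_inj) in kmax *; rewrite kmax -ltnS /=.
  rewrite !mxE !eqxx mulr1 addr0 /cof /cofactor.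
  rewrite -signr_odd (_ : odd _ = false) ?mul1r; last first.
    by rewrite /= /bump leq0n add1n /= oddD /=; case: (odd m).
  congr (\det _); apply/matrixP => i k; rewrite !mxE lift_max.
  by rewrite (_ : lift ord0 ord_max = ord_max) ?lift_max//; apply: val_inj.
rewrite (expand_det_row _ ord_max) big_ord_recl cofE mxE/= mul1r addrC.
congr (_ + _); rewrite mxE.
under [RHS]eq_bigr do rewrite mxE summxE mulr_suml.
rewrite exchange_big/=; apply: eq_bigr => k _.
rewrite (bigD1 (f k))//= big1 ?addr0 => [|l lk]; last first.
  by rewrite !mxE (negbTE lk)/= mulr0 mul0r.
by rewrite cofE !mxE !eqxx/= mulr1 mulrC.
Qed.

End AffineMinors.

(** * Replacing one observation by an independent copy *)

Section Decoupling.
Context {R : realType} d (Omega : measurableType d) (P : probability Omega R).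
Variables (p n : nat) (X : 'I_n -> Omega -> 'cV[R]_p) (i0 : 'I_n).
Hypothesis mX : forall i j, measurable_fun setT (fun w => X i w j 0).
Hypothesis indX : independent_vectors P X.

(* [X i0] is evaluated at the second sample point, the other vectors at the
   first. *)
Definition decoupled (i : 'I_n) (ww : Omega * Omega) : 'cV[R]_p :=
  X i (if i == i0 then ww.2 else ww.1).

Let rect (B : 'I_n -> 'I_p -> set R) : set (Omega * Omega) :=
  [set ww | forall i j, B i j (decoupled i ww j 0)].

Definition decoupled_rects : set (set (Omega * Omega)) :=
  [set E | exists2 B, (forall i j, measurable (B i j)) & E = rect B].

Let measurable_forall (J : finType) d' (T : measurableType d') (A : J -> set T) :
  (forall i, measurable (A i)) -> measurable [set x | forall i, A i x].
Proof.
move=> mA; rewrite (_ : [set _ | _] = \bigcap_(i in [set: J]) A i).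
  by apply: fin_bigcap_measurable => //; exact: finite_finset.
by apply/seteqP; split=> [x Ax i _|x Ax i]; [exact: Ax | exact: (Ax i I)].
Qed.

Let measurable_X (B : 'I_n -> 'I_p -> set R) i :
  (forall i j, measurable (B i j)) ->
  measurable [set w | forall j, B i j (X i w j 0)].
Proof.
move=> mB; apply: measurable_forall => j.
by have := mX i j measurableT (mB i j); rewrite setTI.
Qed.

Let rectE B : rect B =
  [set w | forall (i : 'I_n) j, i != i0 -> B i j (X i w j 0)] `*`
  [set w | forall j, B i0 j (X i0 w j 0)].
Proof.
apply/seteqP; split=> -[w w'] /=.
  move=> h; split=> [i j ii0|j].
    by have := h i j; rewrite /decoupled (negbTE ii0).
  by have := h i0 j; rewrite /decoupled eqxx.
move=> [h h'] i j; rewrite /decoupled.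
by case: eqP => [->|/eqP]; [exact: h' | exact: h].
Qed.

(** Freeing the [i0] factor keeps a rectangle over all indices, to which independence applies. *)
Let without (B : 'I_n -> 'I_p -> set R) (i : 'I_n) j :=
  if i == i0 then setT else B i j.

Let withoutE B : [set w | forall (i : 'I_n) j, i != i0 -> B i j (X i w j 0)] =
  [set w | forall (i : 'I_n) j, without B i j (X i w j 0)].
Proof.
apply/seteqP; split=> w /= h i j.
  by rewrite /without; case: eqP => // /eqP/h.
by move=> /negbTE ii0; have := h i j; rewrite /without ii0.
Qed.

Let measurable_without B i j : (forall i j, measurable (B i j)) ->
  measurable (without B i j).
Proof. by rewrite /without => mB; case: eqP. Qed.

Let measurable_all B : (forall i j, measurable (B i j)) ->
  measurable [set w | forall i j, B i j (X i w j 0)].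
Proof.
by move=> mB; apply: measurable_forall => i; exact: measurable_X.
Qed.

Let measurable_rect B : (forall i j, measurable (B i j)) -> measurable (rect B).
Proof.
move=> mB; rewrite rectE withoutE; apply: measurableX; last exact: measurable_X.
by apply: measurable_all => i j; exact: measurable_without.
Qed.

Let mdiag : measurable_fun setT (fun w : Omega => (w, w)).
Proof. exact: measurable_fun_pair. Qed.

Let diagonal_law : {measure set (Omega * Omega) -> \bar R} :=
  measure_function_pushforward__canonical__measure_function_Measure P mdiag.

(** By independence the law of [(w, w)] and the product measure agree on the pi-system of
    rectangles, hence on the sigma-algebra it generates. *)
Lemma decouplingE (E : set (Omega * Omega)) : <<s decoupled_rects >> E ->
  P [set w | E (w, w)] = (P \x P)%E E.
Proof.
apply: (@g_sigma_algebra_measure_unique _ R _ decoupled_rects _ (fun=> setT) _ _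
  diagonal_law (P \x P)%E).
- by move=> _ [B mB ->]; exact: measurable_rect.
- by move=> _; exists (fun _ _ => setT) => //; apply/seteqP; split.
- by apply/seteqP; split=> // x _; exists 0%N.
- move=> _ _ [B mB ->] [C mC ->].
  exists (fun i j => B i j `&` C i j) => [i j|]; first exact: measurableI.
  apply/seteqP; split=> x /=; first by move=> [xB xC] i j; split.
  by move=> xBC; split=> i j; have [] := xBC i j.
- move=> _ [B mB ->].
  transitivity (P [set w | forall i j, B i j (X i w j 0)]).
    by congr (P _); apply/seteqP; split=> w /= h i j; have := h i j;
      rewrite /decoupled; case: ifP.
  transitivity (P [set w | forall i j, without B i j (X i w j 0%R)] *
      P [set w | forall j, B i0 j (X i0 w j 0%R)])%E; last first.
    rewrite rectE withoutE; apply/esym/product_measure1E.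
      by apply: measurable_all => i j; exact: measurable_without.
    exact: measurable_X.
  rewrite (indX (fun i j => measurable_without i j mB)).
  rewrite (indX mB) (bigD1 i0)//= [in RHS](bigD1 i0)//=.
  rewrite [X in _ = (X * _ * _)%E](_ : _ = 1%E) ?mul1e; last first.
    rewrite -(@probability_setT _ _ _ P); congr (P _).
    by apply/seteqP; split=> w //= _ j; rewrite /without eqxx.
  rewrite muleC; congr (_ * _)%E; apply: eq_bigr => i ii0.
  by rewrite /without (negbTE ii0).
- by move=> _; rewrite /= /pushforward preimage_setT probability_setT ltry.
Qed.

(** Measurability for the sigma-algebra generated by the rectangles is what puts determinant events
    within reach of [decouplingE]. *)
Lemma measurable_decoupled i j :
  measurable_fun (setT : set (g_sigma_algebraType decoupled_rects))
    (fun ww => decoupled i ww j 0).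
Proof.
move=> _ B mB; rewrite setTI; apply: sub_sigma_algebra.
exists (fun i' j' => if (i' == i) && (j' == j) then B else setT).
  by move=> i' j'; case: ifP.
apply/seteqP; split=> ww /= h; last by have := h i j; rewrite !eqxx.
by move=> i' j'; case: andP => // -[/eqP -> /eqP ->].
Qed.

End Decoupling.

Lemma measurable_det d (T : measurableType d) (R : realType) (n : nat)
    (A : T -> 'M[R]_n) :
  (forall i j, measurable_fun setT (fun x => A x i j)) ->
  measurable_fun setT (fun x => \det (A x)).
Proof.
move=> mA; apply: measurable_sum => s; apply: measurable_funM => //.
exact: measurable_prod.
Qed.

Lemma measurable_affine (R : realType) (p : nat) (f : nat -> 'I_p) d
    (T : measurableType d) m (x : nat -> T -> 'cV[R]_p) :
  (forall i j, measurable_fun setT (fun w => x i w j 0)) ->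
  measurable_fun setT (fun w => \det (affine_mx f m (fun i => x i w))).
Proof.
move=> mx; apply: measurable_det => i [[|j] jm]; under eq_fun do rewrite mxE/=.
  exact: measurable_cst.
exact: mx.
Qed.

(** The law of [a^T *m Y] is absolutely continuous with respect to Lebesgue measure, so the point
    [- b] is null. *)
Lemma gaussian_hyperplane (R : realType) d (Omega : measurableType d)
    (P : probability Omega R) (p : nat) (Y : Omega -> 'cV[R]_p) mu Sigma
    (a : 'cV[R]_p) (b : R) :
  gaussian_vector P Y mu Sigma -> a != 0 ->
  P [set w | (a^T *m Y w) 0 0 + b = 0] = 0%E.
Proof.
move=> [_ gY] a0; have := gY a a0 [set - b] (measurable_set1 _).
rewrite [LHS](_ : _ = P [set w | (a^T *m Y w) 0 0 + b = 0]).
  move=> ->.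
  apply: (proj1 (null_content_dominatesP _ _) (normal_prob_dominates _ _)).
    exact: measurable_set1.
  exact: lebesgue_measure_set1.
congr (P _); apply/seteqP; split=> w /= h; first by rewrite h addNr.
by apply/eqP; rewrite -addr_eq0 h.
Qed.

Section GenericPosition.
Context {R : realType} d (Omega : measurableType d) (P : probability Omega R).
Variables (p n : nat) (X : 'I_n.+1 -> Omega -> 'cV[R]_p).
Variables (mu : 'cV[R]_p) (Sigma : 'M[R]_p).
Hypothesis gX : forall i, gaussian_vector P (X i) mu Sigma.
Hypothesis indX : independent_vectors P X.
Variable f : nat -> 'I_p.
Hypothesis finj : forall k l, (k < l < n)%N -> f k != f l.

Let mX i j : measurable_fun setT (fun w => X i w j 0).
Proof. exact: (proj1 (gX i)). Qed.

Let minor m w := \det (affine_mx f m (fun i => X (inord i) w)).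

(* Expanding along the last row, the minor vanishes only if the last vector
   lies in a proper hyperplane determined by the other vectors. *)
Lemma affine_minor_neq0 m : (0 < m <= n.+1)%N ->
  P [set w | \det (affine_mx f m (fun i => X (inord i) w)) = 0] = 0%E.
Proof.
elim: m => // -[_ _|m IHm /= mn].
  rewrite (_ : [set _ | _] = set0) ?measure0//.
  apply/seteqP; split=> w //=.
  by rewrite det_mx11 mxE/= => /eqP; rewrite oner_eq0.
have {}IHm := IHm (ltnW mn).
pose i0 : 'I_n.+1 := inord m.+1.
pose x i ww := decoupled X i0 (inord i) ww.
pose E : set (Omega * Omega) :=
  [set ww | \det (affine_mx f m.+2 (fun i => x i ww)) = 0].
have EG : <<s decoupled_rects X i0 >> E.
  have /(_ measurableT [set 0] (measurable_set1 _)) := @measurable_affine R p f _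
    (g_sigma_algebraType (decoupled_rects X i0)) m.+2 x
    (fun i j => @measurable_decoupled R _ Omega p _ X i0 (inord i) j).
  by rewrite setTI.
have diagE w : affine_mx f m.+2 (fun i => x i (w, w)) =
    affine_mx f m.+2 (fun i => X (inord i) w).
  by apply: eq_affine_mx => i _; rewrite /x /decoupled /= if_same.
rewrite [LHS](_ : _ = P [set w | E (w, w)]); last first.
  by congr (P _); apply/seteqP; split=> w; rewrite /E /= diagE.
rewrite (decouplingE mX indX EG).
have mE : measurable E.
  have mx i j : measurable_fun setT (fun ww => x i ww j 0).
    rewrite /x /decoupled; case: eqP => _.
      exact: (measurableT_comp (mX _ j) measurable_snd).
    exact: (measurableT_comp (mX _ j) measurable_fst).
  have /(_ measurableT [set 0] (measurable_set1 _)) :=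
    @measurable_affine R p f _ (Omega * Omega)%type m.+2 x mx.
  by rewrite setTI.
have section_null w : minor m.+1 w != 0 -> P (xsection E w) = 0%E.
  move=> mw0; pose y i := X (inord i) w.
  have [|a [b [afm expand]]] := @affine_mx_expand R p f m y.
    by move=> k km; apply: finj; rewrite km.
  have a0 : a != 0.
    by apply: contra mw0 => /eqP a0; rewrite /minor -afm a0 mxE.
  rewrite -[RHS](gaussian_hyperplane b (gX i0) a0); congr (P _).
  have detE w' : \det (affine_mx f m.+2 (fun i => x i (w, w'))) =
      (a^T *m X i0 w') 0 0 + b.
    rewrite -expand; congr (\det _); apply: eq_affine_mx => i im.
    rewrite /x /decoupled /y /= /i0 -(inj_eq val_inj)/= !inordK//; last first.
      exact: leq_trans im mn.
    by case: eqP => // ->.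
  by apply/seteqP; split=> w'; rewrite /xsection /= inE /E /= detE.
(* The product measure integrates the measures of the sections, which vanish off the null set given
   by the induction hypothesis. *)
rewrite /product_measure1.
have mfE : measurable_fun setT (P \o xsection E).
  exact: measurable_fun_xsection.
rewrite (ae_eq_integral (cst 0%E))//; first by rewrite integral_cst// mul0e.
exists [set w | minor m.+1 w = 0]; split=> //.
  have /(_ measurableT [set 0] (measurable_set1 _)) := @measurable_affine R p f _
    Omega m.+1 (fun i => X (inord i)) (fun i j => mX (inord i) j).
  by rewrite setTI.
move=> w /= h; apply: contrapT => /eqP mw; apply: h => _.
exact: section_null.
Qed.

End GenericPosition.

(** * The sample covariance matrix *)

Section SampleCovariance.
Context {R : realType} {p r : nat}.
Variable x : 'I_r.+2 -> 'cV[R]_p.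

Let Y : 'M[R]_(p, r.+2) := data_mx x - mean_mx x.
Let widen (j : 'I_r.+1) : 'I_r.+2 := widen_ord (leqnSn r.+1) j.

(* A linear dependency between the first centered observations is an affine
   dependency between all observations. *)
Lemma centered_minor_neq0 (f : nat -> 'I_p) :
  \det (affine_mx f r.+2 (fun i => x (inord i))) != 0 ->
  \det (\matrix_(i < r.+1, j < r.+1) Y (f i) (widen j)) != 0.
Proof.
set A := affine_mx _ _ _; set W := \matrix_(i, j) _; move=> A0.
rewrite -det_tr; apply/det0P => -[v v0 vW].
pose sg := \sum_j v 0 j; pose m : R := r.+2%:R^-1.
(* The weights [v] on centered observations, rewritten as weights on the raw ones: subtracting the
   mean removes [m * sg] from each, and the last has no other weight. *)
pose u : 'rV[R]_r.+2 :=
  \row_j ((if unlift ord_max j is Some k then v 0 k else 0) - m * sg).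
have uw k : u 0 (widen k) = v 0 k - m * sg.
  rewrite mxE (_ : widen k = lift ord_max k) ?liftK//.
  by apply: val_inj; rewrite [RHS]lift_max.
have umax : u 0 ord_max = - (m * sg) by rewrite mxE unlift_none sub0r.
have m0 : m != 0 by rewrite invr_neq0// pnatr_eq0.
have mn : m * r.+2%:R = 1 by rewrite mulVf// pnatr_eq0.
have sumu (g : 'I_r.+2 -> R) : \sum_j u 0 j * g j =
    \sum_k v 0 k * g (widen k) - m * sg * \sum_j g j.
  rewrite big_ord_recr/= umax [X in _ = _ - _ * X]big_ord_recr/= mulrDr opprD.
  rewrite addrA; congr (_ + _); last by rewrite mulNr.
  rewrite mulr_sumr -sumrB; apply: eq_bigr => k _.
  by rewrite -/(widen k) uw mulrBl.
have uA : u *m A = 0.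
  apply/rowP => j; rewrite mxE [RHS]mxE (sumu (A ^~ j)).
  case: j => -[|j] jr.
    rewrite [X in _ - _ * X](eq_bigr (fun=> 1)) => [|i _]; last by rewrite mxE.
    rewrite [X in X - _](eq_bigr (v 0)) => [|i _]; last by rewrite mxE mulr1.
    by rewrite sumr_const card_ord -/sg mulrAC mn mul1r subrr.
  have jr' : (j < r.+1)%N by [].
  move/rowP/(_ (Ordinal jr')): vW; rewrite !mxE => vW.
  rewrite -[RHS]vW.
  under [in RHS]eq_bigr do rewrite !mxE/= mulrBr.
  rewrite sumrB -mulr_suml -/sg; congr (_ - _).
    by apply: eq_bigr => k _; rewrite mxE inord_val.
  rewrite -mulrA mulrCA; congr (_ * (_ * _)).
  by apply: eq_bigr => k _; rewrite mxE inord_val.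
have Au : A \in unitmx by rewrite unitmxE unitfE.
have u0 : u = 0 by rewrite -[u](mulmxK Au) uA mul0mx.
have sg0 : m * sg = 0 by apply/eqP; rewrite -oppr_eq0 -umax u0 mxE.
move/negP: v0; apply; apply/eqP/rowP => k.
by have := uw k; rewrite u0 sg0 subr0 !mxE => <-.
Qed.

(** The right side is the mean of the quadratic forms of [T] at the centered observations; the last,
    nonnegative, one is dropped. *)
Lemma sample_cov_trace_ge (T : 'M[R]_p) : posdef T ->
  let Z := \matrix_(i < p, j < r.+1) (Num.sqrt r.+2%:R^-1 * Y i (widen j)) in
  \tr (Z^T *m T *m Z) <= \tr (sample_cov x *m T).
Proof.
move=> Tpd /=; set Z := \matrix_(i, j) _.
rewrite /sample_cov -/Y -scalemxAl linearZ/=.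
rewrite -[Y *m _ *m T]mulmxA [X in _ * X]mxtrace_mulC.
rewrite /mxtrace [X in _ * X]big_ord_recr/= mulrDr.
apply: ler_wpDr.
  by rewrite mulr_ge0 ?invr_ge0// mulmx_quad posdef_ge0.
rewrite mulr_sumr; apply: ler_sum => j _.
rewrite [leLHS]mulmx_quad [X in _ * X]mulmx_quad -/(widen j).
have -> : col j Z = Num.sqrt r.+2%:R^-1 *: col (widen j) Y.
  by apply/colP => i; rewrite !mxE.
rewrite -scalemxAr [(_ *: _)^T]linearZ/= -!scalemxAl scalerA -expr2.
by rewrite sqr_sqrtr ?invr_ge0// [leLHS]mxE.
Qed.

End SampleCovariance.

(** * Existence for data in general position, and almost surely *)

Lemma pcg_has_solution_generic (R : realType) (r q : nat)
    (x : 'I_r.+2 -> 'cV[R]_(r.+1 + q)) (c rho : R) :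
  (forall s : 'S_(r.+1 + q),
    \det (affine_mx (fun i => s (lshift q (inord i))) r.+2
      (fun i => x (inord i))) != 0) ->
  0 <= rho -> 0 < c -> c * (r.+1 + q)%:R < r.+1%:R ->
  pcg_has_solution (sample_cov x) c rho.
Proof.
move=> gen rho0 c0 cp.
have minor0 (s : 'S_(r.+1 + q)) : \det (\matrix_(i < r.+1, j < r.+1)
    ((\matrix_(i < r.+1 + q, j < r.+1) (Num.sqrt r.+2%:R^-1 *
      (data_mx x - mean_mx x) i (widen_ord (leqnSn r.+1) j)))
      (s (lshift q i)) j)) != 0.
  have := centered_minor_neq0 (gen s).
  set W := \matrix_(i, j) _; set W' := \matrix_(i, j) _ => W0.
  have -> : W' = Num.sqrt r.+2%:R^-1 *: W.
    by apply/matrixP => i j; rewrite !mxE inord_val.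
  by rewrite detZ mulf_neq0// expf_neq0// gt_eqF// sqrtr_gt0 invr_gt0 ltr0n.
have [m [M [delta [m0 delta0 bounds]]]] :=
  sublevel_bounds (@sample_cov_trace_ge _ _ _ x) minor0
    (pcg_obj (sample_cov x) c rho (const_mx 1) 1%:M) rho0 c0 cp.
exact: minimum_attained m0 delta0 bounds.
Qed.

Theorem theorem1 (R : realType) (d : measure_display) (Omega : measurableType d)
    (P : probability Omega R) (p n : nat) (mu : 'cV[R]_p) (Sigma : 'M[R]_p)
    (X : 'I_n -> Omega -> 'cV[R]_p) :
  (2 <= p)%N -> (2 <= n)%N -> (n <= p)%N ->
  posdef Sigma ->
  (forall i, gaussian_vector P (X i) mu Sigma) ->
  independent_vectors P X ->
  {ae P, forall w, forall rho c : R, 0 <= rho -> 0 < c ->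
      c < 1 - (p - n.-1)%N%:R / p%:R ->
      pcg_has_solution (sample_cov (fun i => X i w)) c rho}.
Proof.
move=> _ n2 np _; have [q pE] : exists q, p = (n.-1 + q)%N.
  by exists (p - n.-1)%N; rewrite subnKC// (leq_trans (leq_pred n)).
case: n n2 np X pE => [//|[//|r]] _ _ X /= pE; subst p => gX indX.
(* There are finitely many permutations, and the event involves neither [rho] nor [c], so one null
   set serves all parameters. *)
have gen : {ae P, forall w, forall s : 'S_(r.+1 + q),
    \det (affine_mx (fun i => s (lshift q (inord i))) r.+2
      (fun i => X (inord i) w)) != 0}.
  apply: filter_forall => s; set f := fun i : nat => _.
  exists [set w | \det (affine_mx f r.+2 (fun i => X (inord i) w)) = 0].
  split=> [||w /= /negP/negPn/eqP//].
    have := @measurable_affine R _ f _ Omega r.+2 (fun i => X (inord i))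
      (fun i j => proj1 (gX (inord i)) j).
    by move=> /(_ measurableT [set 0] (measurable_set1 _)); rewrite setTI.
  apply: (affine_minor_neq0 gX indX); last by rewrite leqnn.
  move=> k l /andP[kl lr].
  rewrite (inj_eq perm_inj) (inj_eq (@lshift_inj _ _)) -(inj_eq val_inj)/=.
  by rewrite !inordK ?ltn_eqF// (ltn_trans kl).
apply: filterS gen => w gen rho c rho0 c0 cp.
apply: (pcg_has_solution_generic gen rho0 c0).
(* Multiplying by p turns [c < 1 - k / p] into [c * p < n - 1]. *)
have p0 : (0 : R) < (r.+1 + q)%:R by rewrite ltr0n.
move: cp; rewrite addKn ltrBrDr -(ltr_pM2r p0) mulrDl mulfVK ?gt_eqF//.
by rewrite mul1r -ltrBrDr -natrB ?leq_addl// addnK.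
Qed.
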